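(* Let $\hat\Phi$ be an integrator for the extended Hamiltonian system, and let $\Phi$, with its associated $\varepsilon>0$, be the integrator on the original phase space obtained from $\hat\Phi$ by symmetric projection (see context). If the extended phase space integrator $\hat\Phi$ is symmetric (i.e. $\hat\Phi_{h}^{-1}=\hat\Phi_{-h}$), then the integrator $\Phi$ is symmetric, i.e. $\Phi_{\Delta t}^{-1}=\Phi_{-\Delta t}$ for any $\Delta t\in(-\varepsilon,\varepsilon)$. Moreover, $\Phi$ (as an integrator for the original Hamiltonian system $\dot q=D_2H(q,p)$, $\dot p=-D_1H(q,p)$) has the same order of accuracy as $\hat\Phi$ (as an integrator for the extended system).
   Context: Notation. $T^*\mathbb{R}^d\cong\mathbb{R}^{2d}$ has coordinates $z=(q,p)$, and $T^*\mathbb{R}^{2d}\cong\mathbb{R}^{4d}$ has coordinates $\zeta=(q,x,p,y)$ with $q,x,p,y\in\mathbb{R}^d$. $D_i$ denotes the partial derivative with respect to the $i$-th set of variables. $H\colon T^*\mathbb{R}^d\to\mathbb{R}$ is a (smooth) Hamiltonian. Extended Hamiltonian system on $T^*\mathbb{R}^{2d}$: $\dot q=D_2H(x,p)$, $\dot x=D_2H(q,y)$, $\dot p=-D_1H(q,y)$, $\dot y=-D_1H(x,p)$. An integrator for it is a one-step method, i.e. a (smooth) discrete flow $\hat\Phi\colon\mathbb{R}\times T^*\mathbb{R}^{2d}\to T^*\mathbb{R}^{2d}$, $(h,\zeta)\mapsto\hat\Phi_h(\zeta)$, with $\hat\Phi_0=\mathrm{id}$, approximating the flow of this system. Let $\iota\colon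 T^*\mathbb{R}^d\to T^*\mathbb{R}^{2d}$, $\iota(q,p)=(q,q,p,p)$, and let $A\colon\mathbb{R}^{4d}\to\mathbb{R}^{2d}$ be the linear map $A(q,x,p,y)=(q-x,p-y)$, so that $A^T(\mu_1,\mu_2)=(\mu_1,-\mu_1,\mu_2,-\mu_2)$ and $\ker A=\{(q,q,p,p)\}=\iota(T^*\mathbb{R}^d)$. The integrator $\Phi$: for any $\bar z\in T^*\mathbb{R}^d$ there exist a neighborhood $U$ of $\bar z$ in $T^*\mathbb{R}^d$, $\varepsilon>0$, and maps $\mu\colon(-\varepsilon,\varepsilon)\times U\to\mathbb{R}^{2d}$, $(\Delta t,z)\mapsto\mu_{\Delta t}(z)$, and $\Phi\colon(-\varepsilon,\varepsilon)\times U\to T^*\mathbb{R}^d$, $(\Delta t,z)\mapsto\Phi_{\Delta t}(z)$, such that for any $\Delta t\in(-\varepsilon,\varepsilon)$ and any $z\in U$, $$\iota(\Phi_{\Delta t}(z))=\hat\Phi_{\Delta t}\bigl(\iota(z)+A^T\mu_{\Delta t}(z)\bigr)+A^T\mu_{\Delta t}(z).$$ These are obtained by the implicit function theorem, solving the equations $\zeta=\hat\Phi_{\Delta t}(\iota(z)+A^T\lambda)+A^T\lambda$, $A\zeta=0$ for $(\zeta,\lambda)$ as a function of $(\Delta t,z)$ near $(\Delta t,z)=(0,\bar z)$, $(\zeta,\lambda)=(\iota(\bar z),0)$; then $\lambda=\mu_{\Delta t}(z)$ and $\zeta=\iota(\Phi_{\Delta t}(z))$. This $\Phi$ and this $\varepsilon$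 are the ones in the claim. *)

(* Defs.v *)
From HB Require Import structures.
From mathcomp Require Import all_boot all_order all_algebra.
From mathcomp Require Import all_classical all_reals all_analysis.

Set Implicit Arguments.
Unset Strict Implicit.
Unset Printing Implicit Defensive.

Import Order.TTheory GRing.Theory Num.Theory.
Import numFieldNormedType.Exports.

Local Open Scope classical_set_scope.
Local Open Scope ring_scope.

Section Smoothness.
Context {R : realType} {V W : normedModType R}.

(* Meant for open [A]: then the values of f outside A play no role, and in
   finite dimension this is the usual class C^k on A. *)
Fixpoint Ck_on (A : set V) (k : nat) (f : V -> W) : Prop :=
  if k is k'.+1 then
    (forall x, A x -> differentiable f x) /\
    (forall v, Ck_on A k' ('D_v f))
  else forall x, A x -> {for x, continuous f}.

Definition smooth_on (A : set V) (f : V -> W) : Prop := forall k, Ck_on A k f.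

End Smoothness.

Section OneStepMethods.
Context {R : realType} {V : normedModType R}.

Definition ode_solution (X : V -> V) (T : R) (g : R -> V) : Prop :=
  forall t : R, `|t| < T -> is_derive t 1 g (X (g t)).

(* Psi has order (at least) r on D: the local error is O(h^(r+1)).  The exact
   flow may exist only for short times, so it enters through the solution
   curves g starting at z. *)
Definition has_order (X : V -> V) (D : set V) (Psi : R -> V -> V) (r : nat) :
    Prop :=
  forall (z : V) (T : R) (g : R -> V),
    D z -> 0 < T -> g 0 = z -> ode_solution X T g ->
    (fun h : R => Psi h z - g h) =O_ (nbhs (0 : R)) (fun h : R => h ^+ r.+1).

(* Psi_h^-1 = Psi_(-h) for the maps Psi_h : D -> V, for h in I: the composite
   Psi_(-h) o Psi_h is the identity wherever it is defined.  When I = -I, the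
   case of -h gives the other composite. *)
Definition symmetric_method (I : set R) (D : set V) (Psi : R -> V -> V) :
    Prop :=
  forall (h : R) (z : V),
    I h -> D z -> D (Psi h z) -> Psi (- h) (Psi h z) = z.

Definition discrete_flow (Psi : R -> V -> V) : Prop :=
  smooth_on [set: R * V] (fun hz => Psi hz.1 hz.2) /\ Psi 0 = id.

End OneStepMethods.

Section ExtendedPhaseSpace.
Context {R : realType} {d : nat}.

(* z = (q, p) *)
Definition phase : normedModType R := ('rV[R]_d * 'rV[R]_d)%type.
(* zeta = ((q, x), (p, y)) *)
Definition ext_phase : normedModType R :=
  (('rV[R]_d * 'rV[R]_d) * ('rV[R]_d * 'rV[R]_d))%type.

Definition D1 (H : phase -> R) (q p : 'rV[R]_d) : 'rV[R]_d :=
  \row_(i < d) 'D_(delta_mx 0 i) (fun q' => H (q', p)) q.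

Definition D2 (H : phase -> R) (q p : 'rV[R]_d) : 'rV[R]_d :=
  \row_(i < d) 'D_(delta_mx 0 i) (fun p' => H (q, p')) p.

Definition ham_field (H : phase -> R) (z : phase) : phase :=
  let: (q, p) := z in (D2 H q p, - D1 H q p).

Definition ext_field (H : phase -> R) (zeta : ext_phase) : ext_phase :=
  let: ((q, x), (p, y)) := zeta in
  ((D2 H x p, D2 H q y), (- D1 H q y, - D1 H x p)).

Definition iota_diag (z : phase) : ext_phase :=
  let: (q, p) := z in ((q, q), (p, p)).

Definition Amap (zeta : ext_phase) : phase :=
  let: ((q, x), (p, y)) := zeta in (q - x, p - y).

(* The transpose of [Amap]. *)
Definition Atr (mu : phase) : ext_phase :=
  let: (m1, m2) := mu in ((m1, - m1), (m2, - m2)).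

Definition projection_eqs (Phihat : R -> ext_phase -> ext_phase)
    (dt : R) (z : phase) (zeta : ext_phase) (lambda : phase) : Prop :=
  zeta = Phihat dt (iota_diag z + Atr lambda) + Atr lambda /\ Amap zeta = 0.

(* (U, eps, mu, Phi) is what the implicit function theorem yields near
   (dt, z) = (0, zbar), (zeta, lambda) = (iota zbar, 0): U is an open
   neighborhood of zbar, mu and Phi are smooth on (-eps, eps) x U, and for
   (dt, z) in that set (iota (Phi_dt z), mu_dt z) is the unique solution of the
   equations in some fixed (max-norm) ball around (iota zbar, 0). *)
Definition symmetric_projection (Phihat : R -> ext_phase -> ext_phase)
    (zbar : phase) (U : set phase) (eps : R)
    (mu Phi : R -> phase -> phase) : Prop :=
  [/\ open_nbhs zbar U, 0 < eps,
      smooth_on (`]- eps, eps[ `*` U) (fun hz : R * phase => mu hz.1 hz.2),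
      smooth_on (`]- eps, eps[ `*` U) (fun hz : R * phase => Phi hz.1 hz.2)
    & exists2 delta : R, 0 < delta &
      forall (dt : R) (z : phase), dt \in `]- eps, eps[ -> U z ->
      forall (zeta : ext_phase) (lambda : phase),
        (ball ((iota_diag zbar, 0) : ext_phase * phase) delta (zeta, lambda) /\
         projection_eqs Phihat dt z zeta lambda)
        <-> (zeta = iota_diag (Phi dt z) /\ lambda = mu dt z)].

End ExtendedPhaseSpace.

Arguments phase R d : clear implicits.
Arguments ext_phase R d : clear implicits.

(* Main.v *)
(* Symmetry: if (iota w, m) solves the projection equations at (h, z), then
   (iota z, -m) solves them at (-h, w), and local uniqueness identifies it with
   the solution returned by the method; it lies in the uniqueness ball because
   (iota z, 0) is the solution at time 0.

   Order: Phihat_h - id vanishes at h = 0 and is C^1, hence it has a small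
   Lipschitz constant for small h.  Applying A to the projection equation then
   bounds mu_h(z), and hence the error Phi_h(z) - g(h), by a constant times the
   error of Phihat along iota o g, which solves the extended system. *)
From HB Require Import structures.
Require Import Defs.
From mathcomp Require Import all_boot all_order all_algebra.
From mathcomp Require Import all_classical all_reals all_analysis.
From mathcomp Require Import lra.
Import Order.TTheory GRing.Theory Num.Theory.
Import numFieldNormedType.Exports.
Local Open Scope classical_set_scope.
Local Open Scope ring_scope.

(** * Calculus in finite dimension *)

Definition finite_coordinates {R : realType} (V : normedModType R) : Prop :=
  exists (I : finType) (e : I -> V) (c : I -> {linear V -> R}),
    (forall i v, `|c i v| <= `|v|) /\ forall v, v = \sum_i c i v *: e i.

Lemma finite_coordinates_rV (R : realType) (n : nat) :
  finite_coordinates ('rV[R]_n : normedModType R).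
Proof.
have lin i : linear (fun v : 'rV[R]_n => v 0 i : R^o).
  by move=> k u v; rewrite !mxE.
pose L i := GRing.isLinear.Build _ _ _ _ (fun v : 'rV[R]_n => v 0 i : R^o) (lin i).
exists 'I_n, (fun i => 'e_i).
exists (fun i => HB.pack_for {linear 'rV[R]_n -> R^o}
  (fun v : 'rV[R]_n => v 0 i : R^o) (L i)).
split=> [i v|v] /=; last exact: row_sum_delta.
rewrite [leRHS]/Num.Def.normr /= mx_normrE.
exact: (le_bigmax _ (fun ij : 'I_1 * 'I_n => `|v ij.1 ij.2|) (0, i)).
Qed.

Lemma finite_coordinates_prod (R : realType) (V W : normedModType R) :
  finite_coordinates V -> finite_coordinates W ->
  finite_coordinates ((V * W)%type : normedModType R).
Proof.
move=> [I [e [c [cle cE]]]] [J [f [b [ble bE]]]].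
exists (I + J)%type.
exists (fun k => match k with inl i => (e i, 0) | inr j => (0, f j) end).
exists (fun k => match k with
  | inl i => (c i \o fst : {linear _ -> _})
  | inr j => (b j \o snd : {linear _ -> _}) end).
split=> [[i|j] v|v] /=.
- by rewrite prod_normE (le_trans (cle _ _)) // le_max lexx.
- by rewrite prod_normE (le_trans (ble _ _)) // le_max lexx orbT.
rewrite big_sumType /= [LHS]surjective_pairing {1}(cE v.1) {1}(bE v.2).
apply/pair_equal_spec; split.
  rewrite !(raddf_sum fst) /= [X in _ + X]big1 ?addr0 // => j _.
  exact: scaler0.
rewrite !(raddf_sum snd) /= [X in X + _]big1 ?add0r // => j _.
exact: scaler0.
Qed.

Lemma is_derive_linear (R : realType) (U V W : normedModType R)
    (l : {linear V -> W}) (f : U -> V) (a v : U) (df : V) :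
  continuous l -> is_derive a v f df -> is_derive a v (l \o f) (l df).
Proof.
move=> lc [fd <-].
have H : h^-1 *: (((l \o f) \o shift a) (h *: v) - (l \o f) a) @[h --> 0^']
    --> l ('D_v f a).
  under eq_fun do rewrite /= -linearB -linearZ.
  exact: (continuous_cvg _ (lc _) fd).
split; first by apply/cvg_ex; exists (l ('D_v f a)).
exact: cvg_lim H.
Qed.

Lemma is_derive_line (R : realType) (V W : normedModType R) (f : V -> W)
    (a v : V) (t : R) (df : W) :
  is_derive (a + t *: v) v f df ->
  is_derive t 1 (fun s : R => f (a + s *: v)) df.
Proof.
move=> [fd fE].
have E : (fun h : R => h^-1 *: (((fun s : R => f (a + s *: v)) \o shift t) (h *: 1)
     - f (a + t *: v))) =
   (fun h => h^-1 *: ((f \o shift (a + t *: v)) (h *: v) - f (a + t *: v))).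
  apply/funext => h /=; do 3 f_equal.
  by rewrite -[h%:A]/(h * 1) mulr1 scalerDl addrCA.
by split; rewrite /derivable /derive ?E.
Qed.

(** The scalar mean value theorem applies to each coordinate of [g], at a point depending on the
    coordinate; summing the coordinate bounds costs a factor that depends on [W] only. *)
Lemma mean_value_inequality (R : realType) (W : normedModType R) :
  finite_coordinates W ->
  exists2 K : R, 0 < K & forall (g dg : R -> W) (M : R),
    (forall t : R, t \in `[0, 1] -> is_derive t 1 g (dg t) /\ `|dg t| <= M) ->
    `|g 1 - g 0| <= K * M.
Proof.
move=> [I [e [c [cle cE]]]].
have cc i : continuous (c i : W -> R).
  apply/linear_bounded_continuous/linear_boundedP.
  exists 1; split=> // r /ltW r1 x.
  by rewrite (le_trans (cle i x)) // ler_peMl.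
(* The summand 1 keeps the constant positive when all [e i] vanish. *)
exists (1 + \sum_i `|e i|); first by rewrite ltr_pwDl // sumr_ge0.
move=> g dg M gM.
have M0 : 0 <= M.
  have [|_] := gM 0; first by rewrite in_itv /= lexx ler01.
  exact: le_trans.
have coord i : `|c i (g 1 - g 0)| <= M.
  have der (t : R) : t \in `[0, 1] -> is_derive t 1 (c i \o g) (c i (dg t)).
    by move=> /gM[/(is_derive_linear _ _ _ _ (c i)) + _]; apply; exact: cc.
  have drv (t : R) : t \in `]0, 1[ -> is_derive t 1 (c i \o g) (c i (dg t)).
    by move=> t01; apply: der; exact: subset_itv_oo_cc t01.
  have cont : {within `[0, 1], continuous (c i \o g)}.
    by apply: derivable_within_continuous => t /der d1; exact: ex_derive.
  have [t t01 E] := MVT_segment ler01 drv cont.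
  have [_ dM] := gM t t01.
  have -> : c i (g 1 - g 0) = c i (dg t) by move: E; rewrite linearB subr0 mulr1.
  exact: le_trans (cle _ _) dM.
rewrite [X in `|X|]cE (le_trans (ler_norm_sum _ _ _)) //.
rewrite mulrDl mul1r mulr_suml -[leLHS]add0r lerD // ler_sum // => i _.
by rewrite normrZ mulrC ler_wpM2l.
Qed.

(* [Ck_on] controls one direction at a time; finite dimension of V makes the
   smallness of the derivative uniform in the direction. *)
Lemma C1_small_lipschitz (R : realType) (V W : normedModType R)
    (G : R * V -> W) (a : V) (k : R) :
  finite_coordinates V -> finite_coordinates W -> Ck_on setT 1 G ->
  (forall v, G (0, v) = 0) -> 0 < k ->
  exists2 r : R, 0 < r & forall (h : R) (v : V), `|h| < r -> `|v| < r ->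
    `|G (h, a + v) - G (h, a)| <= k * `|v|.
Proof.
move=> [I [e [c [cle cE]]]] /mean_value_inequality[K K0 mvi] [Gd Gc] G0 k0.
(* On the slice h = 0 the map [G] is constantly zero, so its derivatives along that slice vanish. *)
have D0 i : 'D_(0, e i) G (0, a) = 0.
  rewrite /derive (_ : (fun h : R => _) = cst 0); first exact: lim_cst.
  apply/funext => h /=; have -> : h *: ((0 : R), e i) + (0, a) = (0, h *: e i + a).
    by apply/pair_equal_spec; rewrite /= scaler0 addr0.
  by rewrite !G0 subrr scaler0.
have n0 : 0 < #|I|%:R + 1 :> R by rewrite ltr_wpDl.
(* With [k'] bounding the derivative along each of the [#|I|] directions, the mean value inequality
   yields the factor [K * k' * #|I|], which is at most [k]. The added 1 avoids division by zero for
   an empty [I]. *)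
have [k' k'0 Kk'] : exists2 k' : R, 0 < k' & K * k' = k / (#|I|%:R + 1).
  exists (k / (#|I|%:R + 1) / K); first by rewrite !divr_gt0.
  by rewrite mulrC divfK ?gt_eqF.
have near_small i : \forall x \near ((0 : R), a), `|'D_(0, e i) G x| <= k'.
  have Di : 'D_(0, e i) G x @[x --> ((0 : R), a)] --> (0 : W).
    by rewrite -(D0 i); exact: Gc.
  exact: (cvgr0_norm_le _ Di).
have : \forall x \near ((0 : R), a), forall i, `|'D_(0, e i) G x| <= k'.
  exact: (filter_forall _ near_small).
move=> /nbhs_normP[r /= r0 Br].
exists r => // h v hr vr.
pose x (t : R) := (h, a) + t *: ((0 : R), v).
have xE t : x t = (h, a + t *: v).
  by apply/pair_equal_spec; rewrite /= scaler0 addr0.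
have := mvi (fun t => G (x t)) (fun t => 'D_(0, v) G (x t)) (k' * (#|I|%:R * `|v|)).
rewrite !xE scale0r scale1r addr0 => H.
have {}H : `|G (h, a + v) - G (h, a)| <= K * (k' * (#|I|%:R * `|v|)).
  apply: H => t; rewrite in_itv /= => /andP[t0 t1]; split.
    by apply/is_derive_line/derivableP/diff_derivable/Gd.
  (* Linearity of the differential reduces the direction [v] to the finitely many directions [e i],
     with coefficients bounded by the norm of [v]. *)
  have -> : (0, v) = \sum_i c i v *: (0, e i) :> R * V.
    rewrite [LHS]surjective_pairing [RHS]surjective_pairing /=.
    rewrite (raddf_sum fst) (raddf_sum snd) /= -cE.
    by rewrite big1 // => i _; exact: scaler0.
  rewrite deriveE ?linear_sum; last exact: Gd.
  rewrite (le_trans (ler_norm_sum _ _ _)) //.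
  rewrite mulrCA mulr_natl -sumr_const ler_sum // => i _.
  rewrite linearZ normrZ mulrC ler_pM //.
  rewrite -deriveE; last exact: Gd.
  apply: Br; rewrite xE /ball_ /= prod_normE /= gt_max sub0r normrN hr opprD.
  rewrite addNKr normrN.
  by rewrite normrZ (le_lt_trans _ vr) // ler_piMl // ger0_norm.
rewrite (le_trans H) // !mulrA ler_wpM2r //.
by rewrite Kk' mulrAC ler_pdivrMr // ler_pM2l // lerDl.
Qed.

(** Taken with [l] the second projection, this makes (h, v) |-> Phihat_h(v) - v a C^1 map. *)
Lemma Ck_on1_sub_linear (R : realType) (V W : normedModType R)
    (f : V -> W) (l : {linear V -> W}) :
  continuous l -> Ck_on setT 1 f -> Ck_on setT 1 (f \- l).
Proof.
move=> lc [fd fc]; have ld x : differentiable l x by exact: linear_differentiable.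
split=> [x _|v x _]; first by apply: differentiableB => //; exact: fd.
have -> : 'D_v (f \- l) = 'D_v f \- cst (l v).
  apply/funext => y /=; rewrite deriveB; try exact/diff_derivable.
    by congr (_ - _); rewrite deriveE // diff_lin.
  exact/diff_derivable/fd.
by apply: continuousB; [exact: fc | exact: cst_continuous].
Qed.

(** * The linear maps of the projection *)

Section LinearMaps.
Context (R : realType) (d : nat).

Lemma iota_diag_linear : linear (@iota_diag R d).
Proof. by move=> k [q p] [q' p']. Qed.

HB.instance Definition _ :=
  GRing.isLinear.Build _ _ _ _ (@iota_diag R d) iota_diag_linear.

Lemma Amap_linear : linear (@Amap R d).
Proof.
move=> k [[q x] [p y]] [[q' x'] [p' y']]; apply/pair_equal_spec => /=.
by split; rewrite scalerBr opprD addrACA.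
Qed.

HB.instance Definition _ := GRing.isLinear.Build _ _ _ _ (@Amap R d) Amap_linear.

Lemma Atr_linear : linear (@Atr R d).
Proof.
move=> k [q p] [q' p']; rewrite /Atr /=.
by apply/pair_equal_spec; split; apply/pair_equal_spec; rewrite /= opprD scalerN.
Qed.

HB.instance Definition _ := GRing.isLinear.Build _ _ _ _ (@Atr R d) Atr_linear.

Lemma norm_iota_diag (z : phase R d) : `|iota_diag z| = `|z|.
Proof. by case: z => q p; rewrite !prod_normE /= !maxxx. Qed.

Lemma norm_Atr (m : phase R d) : `|Atr m| = `|m|.
Proof. by case: m => q p; rewrite !prod_normE /= !normrN !maxxx. Qed.

Lemma norm_Amap (zeta : ext_phase R d) : `|Amap zeta| <= 2 * `|zeta|.
Proof.
case: zeta => [[q x] [p y]]; rewrite [leLHS]prod_normE /= ge_max mulr_natl mulr2n.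
apply/andP; split; rewrite (le_trans (ler_normB _ _)) // lerD //;
  by rewrite !prod_normE /= !le_max lexx ?orbT.
Qed.

Lemma Amap_iota_diag (z : phase R d) : Amap (iota_diag z) = 0.
Proof. by case: z => q p; apply/pair_equal_spec; rewrite !subrr. Qed.

(** Invertibility of A A^T is what lets the multiplier be recovered from the projection
    equations. *)
Lemma Amap_Atr (m : phase R d) : Amap (Atr m) = 2 *: m.
Proof.
by case: m => q p; apply/pair_equal_spec; rewrite /= !opprK !scaler_nat !mulr2n.
Qed.

Lemma iota_diag_continuous : continuous (@iota_diag R d).
Proof.
apply/linear_bounded_continuous/linear_boundedP; exists 1; split=> // r /ltW r1 z.
by rewrite norm_iota_diag ler_peMl.
Qed.

End LinearMaps.

(** * The diagonal embedding and a single projected step *)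

Lemma iota_diag_inj (R : realType) (d : nat) : injective (@iota_diag R d).
Proof. by move=> [q p] [q' p'] [-> _ ->]. Qed.

Lemma ext_field_iota_diag (R : realType) (d : nat) (H : phase R d -> R)
    (z : phase R d) :
  ext_field H (iota_diag z) = iota_diag (ham_field H z).
Proof. by case: z. Qed.

Lemma ode_solution_iota_diag (R : realType) (d : nat) (H : phase R d -> R)
    (T : R) (g : R -> phase R d) :
  ode_solution (ham_field H) T g -> ode_solution (ext_field H) T (iota_diag \o g).
Proof.
move=> gsol t tT; rewrite /= ext_field_iota_diag.
exact: (is_derive_linear _ _ _ _ iota_diag _ _ _ _
  (@iota_diag_continuous R d) (gsol t tT)).
Qed.

(** The equation at (h, z) says that Phihat_h sends iota z + A^T m to iota w - A^T m. Applying
    Phihat_(-h) exchanges the two points, which turns m into -m. *)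
Lemma projection_eqs_sym (R : realType) (d : nat)
    (Phihat : R -> ext_phase R d -> ext_phase R d) (h : R) (z w m : phase R d) :
  symmetric_method setT setT Phihat ->
  projection_eqs Phihat h z (iota_diag w) m ->
  projection_eqs Phihat (- h) w (iota_diag z) (- m).
Proof.
move=> sym [E _]; split; last exact: Amap_iota_diag.
by rewrite E raddfN addrK sym // addrK.
Qed.

Arguments Amap : simpl never.
Arguments iota_diag : simpl never.
Arguments Atr : simpl never.

Lemma finite_coordinates_ext_phase (R : realType) (d : nat) :
  finite_coordinates (ext_phase R d).
Proof.
do 2 apply: finite_coordinates_prod; exact: finite_coordinates_rV.
Qed.

Lemma projection_ball (R : realType) (d : nat) (zbar : phase R d) (delta : R)
    (zeta : ext_phase R d) (lambda : phase R d) :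
  ball ((iota_diag zbar, 0) : ext_phase R d * phase R d) delta (zeta, lambda) <->
  `|iota_diag zbar - zeta| < delta /\ `|lambda| < delta.
Proof.
by rewrite -ball_normE /ball_ /= prod_normE /= gt_max sub0r normrN; split=> /andP.
Qed.

(** Let e be the increment of Phihat_h - id between iota z and iota z + A^T m, and D = Phihat_h(iota
    z) - iota y. Then iota(w - y) = e + D + 2 A^T m. Since A kills the left side and A A^T = 2, it
    follows that 4m = -(Ae + AD). With e at most a quarter of m in norm, both m and w - y are
    controlled by D. *)
Lemma projection_error (R : realType) (d : nat)
    (Phihat : R -> ext_phase R d -> ext_phase R d) (h : R) (z w y m : phase R d) :
  projection_eqs Phihat h z (iota_diag w) m ->
  `|(Phihat h (iota_diag z + Atr m) - (iota_diag z + Atr m)) -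
    (Phihat h (iota_diag z) - iota_diag z)| <= 4^-1 * `|Atr m| ->
  `|w - y| <= 4 * `|Phihat h (iota_diag z) - iota_diag y|.
Proof.
move=> [E _].
set e := (X in `|X| <= _); set D := _ - iota_diag y => eB.
have sumE : iota_diag (w - y) = e + D + 2 *: Atr m.
  have telescope (V : zmodType) (p q u a b : V) :
      p - (u + a) - (q - u) + (q - b) + (a + a) = p + a - b.
    by rewrite opprB -(addrA _ (u - q)) subrKA [u + a]addrC opprD (addrA p) subrKA
      addrAC subrKA addrAC.
  by rewrite linearB /= E /e /D scaler_nat mulr2n telescope.
have : Amap (iota_diag (w - y)) = Amap e + Amap D + 4 *: m.
  by rewrite sumE !linearD linearZ /= Amap_Atr scalerA -natrM.
rewrite Amap_iota_diag => /esym/eqP; rewrite addrC addr_eq0 => /eqP mE.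
have mB : 4 * `|m| <= 2 * `|e| + 2 * `|D|.
  rewrite -[4]ger0_norm // -normrZ mE normrN (le_trans (ler_normD _ _)) //.
  by rewrite lerD // norm_Amap.
rewrite norm_Atr in eB.
rewrite -norm_iota_diag sumE (le_trans (ler_normD _ _)) //.
rewrite normrZ norm_Atr ger0_norm //.
have := ler_normD e D; have := normr_ge0 D; lra.
Qed.

(** * Symmetry and order of the projected method *)

Theorem proposition3 (R : realType) (d : nat) (H : phase R d -> R)
    (Phihat : R -> ext_phase R d -> ext_phase R d)
    (zbar : phase R d) (U : set (phase R d)) (eps : R)
    (mu Phi : R -> phase R d -> phase R d) :
  smooth_on setT H ->
  discrete_flow Phihat ->
  symmetric_projection Phihat zbar U eps mu Phi ->
  (symmetric_method setT setT Phihat ->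
   symmetric_method `]- eps, eps[ U Phi) /\
  (forall r : nat,
     has_order (ext_field H) setT Phihat r ->
     has_order (ham_field H) U Phi r).
Proof.
move=> _ [Phihat_smooth Phihat0] [Unbhs eps0 mu_smooth _ [delta _ sol]].
have in_eps0 : 0 \in `]- eps, eps[ by rewrite in_itv /= oppr_lt0 eps0.
have solP h z : h \in `]- eps, eps[ -> U z ->
    [/\ `|iota_diag zbar - iota_diag (Phi h z)| < delta, `|mu h z| < delta
      & projection_eqs Phihat h z (iota_diag (Phi h z)) (mu h z)].
  by move=> hI Uz; have [_ /(_ (conj erefl erefl))[/projection_ball[]]] :=
    sol h z hI Uz (iota_diag (Phi h z)) (mu h z).
(* As Phihat_0 = id, the constraint A zeta = 0 becomes 4 mu_0(z) = 0. *)
have mu0 z : U z -> mu 0 z = 0.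
  move=> Uz; have [_ _ [E /eqP]] := solP 0 z in_eps0 Uz.
  rewrite E Phihat0 !linearD /= Amap_iota_diag add0r Amap_Atr -scalerDl.
  by rewrite scaler_eq0 -natrD pnatr_eq0 => /eqP.
have Phi0 z : U z -> Phi 0 z = z.
  move=> Uz; have [_ _ [E _]] := solP 0 z in_eps0 Uz.
  by apply: iota_diag_inj; rewrite E mu0 // Phihat0 linear0 !addr0.
split.
  move=> sym h z hI Uz Uw; set w := Phi h z in Uw *.
  have hNI : - h \in `]- eps, eps[.
    by move: hI; rewrite /= !in_itv /= ltrNl ltrNr opprK andbC.
  have [_ mB eqs] := solP h z hI Uz.
  (* At time 0 the method returns z itself, which places [iota_diag z] within [delta] of
     [iota_diag zbar]. *)
  have [zB _ _] := solP 0 z in_eps0 Uz.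
  rewrite Phi0 // in zB.
  have [+ _] := sol (- h) w hNI Uw (iota_diag z) (- mu h z).
  case; last by move=> /iota_diag_inj.
  split; first by apply/projection_ball; rewrite normrN.
  exact: projection_eqs_sym.
move=> r ord z T g Uz T0 g0 gsol.
have /eqO_exP[K K0 Kord] := ord (iota_diag z) T (iota_diag \o g) I T0
  (congr1 _ g0) (ode_solution_iota_diag _ _ _ _ _ gsol).
have snd_cont : continuous (@snd R (ext_phase R d)).
  by move=> x; exact: cvg_snd.
have GC1 := Ck_on1_sub_linear _ _ _ _ _ snd_cont (Phihat_smooth 1).
(* The constant 1/4 is the one that [projection_error] asks for. *)
have [||||rho rho0 lip] := C1_small_lipschitz _ _ _ _ (iota_diag z) 4^-1 _ _ GC1.
- exact: finite_coordinates_ext_phase.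
- exact: finite_coordinates_ext_phase.
- by move=> v /=; rewrite Phihat0 subrr.
- by rewrite invr_gt0.
apply/eqO_exP; exists (4 * K); first by rewrite mulr_gt0.
(* Continuity of mu at (0, z), where it vanishes, brings A^T mu_h(z) into the ball of radius [rho]
   on which the Lipschitz bound holds. *)
have muC : mu h z @[h --> (0 : R)] --> (0 : phase R d).
  rewrite -(mu0 z Uz).
  have muC := mu_smooth 0 (0, z) (conj in_eps0 Uz).
  have pairC : (h, z) @[h --> (0 : R)] --> ((0 : R), z).
    exact: (cvg_pair cvg_id (cvg_cst z)).
  exact: (cvg_comp _ _ pairC muC).
near=> h.
have hI : h \in `]- eps, eps[.
  by near: h; apply: near_in_itvoo.
have [_ _ eqs] := solP h z hI Uz.
rewrite -mulrA (le_trans (projection_error _ _ _ _ _ _ (g h) _ eqs _)) //.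
  apply: (lip h (Atr (mu h z))).
    by near: h; exact: (cvgr0_norm_lt _ cvg_id).
  rewrite norm_Atr; near: h; exact: (cvgr0_norm_lt _ muC).
by rewrite ler_wpM2l //; near: h; exact: Kord.
Unshelve. all: by end_near. Qed.
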